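(* Let $\mathbf r(t)=r(t)\,\mathbf e(t)\in\mathbb R^2$ be a time-dependent plane vector with $\mathbf e(t)=\begin{pmatrix}\cos\varphi(t)\\ \sin\varphi(t)\end{pmatrix}$, where $r$ and $\varphi$ are sufficiently often differentiable real functions of time $t$. For each integer $k\ge 0$ let $a_\parallel^{(k)}$ and $a_\perp^{(k)}$ be the components of the $k$-th time derivative $\mathbf r^{(k)}$ with respect to the basis $\{\mathbf e,\tilde{\mathbf e}\}$, i.e. $\mathbf r^{(k)}=a_\parallel^{(k)}\mathbf e+a_\perp^{(k)}\tilde{\mathbf e}$. Then the components of the $(k+1)$-th time derivative satisfy the linear recurrence $$\mathbf r^{(k+1)}=\bigl(\dot a_\parallel^{(k)}-\dot\varphi\,a_\perp^{(k)}\bigr)\,\mathbf e+\bigl(\dot a_\perp^{(k)}+\dot\varphi\,a_\parallel^{(k)}\bigr)\,\tilde{\mathbf e},$$ that is, $a_\parallel^{(k+1)}=\dot a_\parallel^{(k)}-\dot\varphi\,a_\perp^{(k)}$ and $a_\perp^{(k+1)}=\dot a_\perp^{(k)}+\dot\varphi\,a_\parallel^{(k)}$.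
   Context: $\mathbf J=\begin{pmatrix}0&-1\\1&0\end{pmatrix}$, and for a vector $\mathbf a\in\mathbb R^2$ one writes $\tilde{\mathbf a}=\mathbf J\mathbf a$. Thus $\{\mathbf e,\tilde{\mathbf e}\}$ is an orthonormal basis moving with $\mathbf r$. Dots denote time derivatives; $\mathbf r^{(k)}$ is the $k$-th time derivative of $\mathbf r$ with $\mathbf r^{(0)}=\mathbf r$. For the scalars $a_\parallel^{(k)},a_\perp^{(k)}$ the superscript $(k)$ is only an index, and $\dot a_\parallel^{(k)},\dot a_\perp^{(k)}$ are their first time derivatives; $a_\parallel^{(0)}=r$, $a_\perp^{(0)}=0$. *)

(* Defs.v *)
From HB Require Import structures.
From mathcomp Require Import all_boot all_order all_algebra.
From mathcomp Require Import all_classical all_reals all_analysis.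
Set Implicit Arguments.
Unset Strict Implicit.
Unset Printing Implicit Defensive.
Import Order.TTheory GRing.Theory Num.Theory.
Import numFieldNormedType.Exports.
Local Open Scope ring_scope.
Local Open Scope classical_set_scope.

Definition Jmx (R : realType) : 'M[R]_2 :=
  \matrix_(i, j) nth 0 (nth [::] [:: [:: 0; -1];
                                     [:: 1;  0]] i) j.

Definition tilde (R : realType) (a : 'cV[R]_2) : 'cV[R]_2 := Jmx R *m a.

Definition dirvec (R : realType) (phi : R -> R) (t : R) : 'cV[R]_2 :=
  \col_i nth 0 [:: cos (phi t); sin (phi t)] i.

Definition position (R : realType) (r phi : R -> R) (t : R) : 'cV[R]_2 :=
  r t *: dirvec phi t.

(* The library's iterated derivative [derive1n j f] is total, so the existence of
   the first [n] derivatives on [D] has to be asserted separately. *)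
Definition times_derivable (R : realType) (n : nat) (D : set R) (f : R -> R) :=
  forall j : nat, (j < n)%N -> forall t : R, D t -> derivable (derive1n j f) t 1.

Definition has_components (R : realType) (e u : 'cV[R]_2) (a b : R) :=
  u = a *: e + b *: tilde e.

(* Main.v *)
Require Import Defs.
From HB Require Import structures.
From mathcomp Require Import all_boot all_order all_algebra.
From mathcomp Require Import all_classical all_reals all_analysis.
From mathcomp Require Import ring.
Import Order.TTheory GRing.Theory Num.Theory.
Import numFieldNormedType.Exports.
Local Open Scope ring_scope.
Local Open Scope classical_set_scope.

Set Implicit Arguments.
Unset Strict Implicit.

(* Cartesian coordinates reduce the differentiability of r^(k) to closure of
   C^k-type regularity under products and composition with sin and cos; the
   components in the moving frame are then rotated Cartesian coordinates, hence
   differentiable.  Differentiating a_par = <r^(k), e> and a_perp = <r^(k), J e>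
   with e' = phi' (J e) and (J e)' = - phi' e gives the recurrence. *)

(** Derivatives depend only on germs, and openness of [D] turns equality on [D] into equality of
    germs at its points. *)
Lemma open_near_eq (R : realType) (T : Type) (D : set R) (f g : R -> T) :
  open D -> (forall t, D t -> f t = g t) ->
  forall t, D t -> {near t, f =1 g}.
Proof.
move=> oD fg t Dt; near=> s; apply: fg; near: s; exact: open_nbhs_nbhs.
Unshelve. all: by end_near. Qed.

Lemma eq_derive1n_in (R : realType) (V : normedModType R) (D : set R)
    (f g : R -> V) :
  open D -> (forall t, D t -> f t = g t) ->
  forall n t, D t -> derive1n n f t = derive1n n g t.
Proof.
move=> oD fg; elim=> [|n IHn] t Dt; first exact: fg.
rewrite !derive1nS !derive1E; apply: near_eq_derive; exact: open_near_eq IHn _ _.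
Qed.

(** Peels the innermost derivative, whereas [derive1nS] peels the outermost. The closure lemmas
    below can then replace [derive1 f] by an explicit formula and apply the induction hypothesis to
    it. *)
Lemma times_derivableS (R : realType) n (D : set R) (f : R -> R) :
  times_derivable n.+1 D f <->
  (forall t, D t -> derivable f t 1) /\ times_derivable n D (derive1 f).
Proof.
have E j : derive1n j.+1 f = derive1n j (derive1 f).
  by rewrite /derive1n iterSr.
split=> [df|[df df'] [|j] // jn t Dt]; last by rewrite E; exact: df'.
split=> [t Dt|j jn t Dt]; first exact: (df 0%N).
by rewrite -E; exact: df.
Qed.

Lemma times_derivableW (R : realType) n (D : set R) (f : R -> R) :
  times_derivable n.+1 D f -> times_derivable n D f.
Proof. by move=> df j jn; apply: df; apply: ltnW. Qed.

Lemma eq_times_derivable (R : realType) n (D : set R) (f g : R -> R) :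
  open D -> (forall t, D t -> f t = g t) ->
  times_derivable n D f -> times_derivable n D g.
Proof.
move=> oD fg df j jn t Dt; apply: near_eq_derivable (df j jn t Dt).
exact: open_near_eq (eq_derive1n_in oD fg j) _ _.
Qed.

Lemma times_derivableD (R : realType) n (D : set R) (f g : R -> R) :
  open D -> times_derivable n D f -> times_derivable n D g ->
  times_derivable n D (f \+ g).
Proof.
move=> oD; elim: n f g => [//|n IHn] f g.
move=> /times_derivableS[df df'] /times_derivableS[dg dg'].
apply/times_derivableS; split=> [t Dt|].
  by apply: derivableD; [exact: df|exact: dg].
apply: (eq_times_derivable oD) (IHn _ _ df' dg') => t Dt.
by rewrite /= !derive1E deriveD //; [exact: df|exact: dg].
Qed.

Lemma times_derivableN (R : realType) n (D : set R) (f : R -> R) :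
  open D -> times_derivable n D f -> times_derivable n D (\- f).
Proof.
move=> oD; elim: n f => [//|n IHn] f /times_derivableS[df df'].
apply/times_derivableS; split=> [t Dt|]; first exact/derivableN/df.
apply: (eq_times_derivable oD) (IHn _ df') => t Dt.
by rewrite /= !derive1E deriveN //; exact: df.
Qed.

(** The Leibniz rule mixes derivatives with the undifferentiated factors, so the latter are weakened
    to order [n] before the induction hypothesis applies. *)
Lemma times_derivableM (R : realType) n (D : set R) (f g : R -> R) :
  open D -> times_derivable n D f -> times_derivable n D g ->
  times_derivable n D (f \* g).
Proof.
move=> oD; elim: n f g => [//|n IHn] f g dfS dgS.
have [df df'] := (times_derivableS _ _ _).1 dfS.
have [dg dg'] := (times_derivableS _ _ _).1 dgS.
apply/times_derivableS; split=> [t Dt|].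
  by apply: derivableM; [exact: df|exact: dg].
have := times_derivableD oD (IHn _ _ (times_derivableW dfS) dg')
  (IHn _ _ (times_derivableW dgS) df').
apply: (eq_times_derivable oD) => t Dt.
by rewrite /= !derive1E deriveM //; [exact: df|exact: dg].
Qed.

(** The two claims go through one induction because the derivative of each function involves the
    other. *)
Lemma times_derivable_cos_sin (R : realType) n (D : set R) (f : R -> R) :
  open D -> times_derivable n D f ->
  times_derivable n D (cos \o f) /\ times_derivable n D (sin \o f).
Proof.
move=> oD; elim: n f => [//|n IHn] f dfS.
have [df df'] := (times_derivableS _ _ _).1 dfS.
have [dc ds] := IHn _ (times_derivableW dfS).
have Df t : D t -> is_derive t 1 f (derive1 f t).
  by move=> Dt; rewrite derive1E; apply/derivableP/df.
split; apply/times_derivableS; split=> [t Dt|].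
- by have := Df t Dt => ?; apply: ex_derive.
- have := times_derivableM oD (times_derivableN oD ds) df'.
  apply: (eq_times_derivable oD) => t Dt; have := Df t Dt => ?.
  by rewrite [RHS]derive1E derive_val /= mulrC.
- by have := Df t Dt => ?; apply: ex_derive.
- have := times_derivableM oD dc df'.
  apply: (eq_times_derivable oD) => t Dt; have := Df t Dt => ?.
  by rewrite [RHS]derive1E derive_val /= mulrC.
Qed.

(** Differentiating a matrix entrywise requires the matrix function to be derivable; at each order
    this comes from the entries, via the induction hypothesis near [t]. *)
Lemma derive1n_mx (R : realType) m p n (D : set R)
    (M : R -> 'M[R]_(m.+1, p.+1)) :
  open D -> (forall i j, times_derivable n D (fun t => M t i j)) ->
  forall l, (l <= n)%N -> forall t, D t ->
  forall i j, derive1n l M t i j = derive1n l (fun t => M t i j) t.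
Proof.
move=> oD dM; elim=> [//|l IHl] ln t Dt i j.
have near_l i' j' : {near t, derive1n l (fun t => M t i' j') =1
                              (fun s => derive1n l M s i' j')}.
  apply: (open_near_eq oD) Dt => s Ds; by rewrite (IHl (ltnW ln)).
rewrite !derive1nS !derive1E derive_mx.
  by rewrite mxE; apply/esym/near_eq_derive/near_l.
by apply/derivable_mxP => i' j'; apply: near_eq_derivable (near_l i' j') _; exact: dM.
Qed.

Lemma derivable_derive1n_mx (R : realType) m p n (D : set R)
    (M : R -> 'M[R]_(m.+1, p.+1)) :
  open D -> (forall i j, times_derivable n D (fun t => M t i j)) ->
  forall l, (l < n)%N -> forall t, D t -> derivable (derive1n l M) t 1.
Proof.
move=> oD dM l ln t Dt; apply/derivable_mxP => i j.
apply: near_eq_derivable (dM i j l ln t Dt).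
by apply: (open_near_eq oD) Dt => s Ds; rewrite (derive1n_mx oD dM (ltnW ln)).
Qed.

Lemma frame_combE (R : realType) (phi : R -> R) (t a b : R) :
  let u := a *: dirvec phi t + b *: tilde (dirvec phi t) in
  u 0 0 = a * cos (phi t) - b * sin (phi t) /\
  u 1 0 = a * sin (phi t) + b * cos (phi t).
Proof.
by split; rewrite !mxE /= !big_ord_recl !big_ord0 !mxE /=; ring.
Qed.

(** The frame is orthonormal, so the components are the inner products with its vectors, that is,
    [u] rotated by [- phi t]. *)
Lemma has_componentsP (R : realType) (phi : R -> R) (t a b : R) (u : 'cV[R]_2) :
  has_components (dirvec phi t) u a b <->
  a = u 0 0 * cos (phi t) + u 1 0 * sin (phi t) /\
  b = u 1 0 * cos (phi t) - u 0 0 * sin (phi t).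
Proof.
have cs : cos (phi t) ^+ 2 = 1 - sin (phi t) ^+ 2 := cos2sin2 (phi t).
split=> [->|[-> ->]].
  have [-> ->] := frame_combE phi t a b; split; ring: cs.
apply/matrixP => i j; rewrite (ord1 j).
set x := (X in X *: _ + _); set y := (X in _ + X *: _).
have [E0 E1] := frame_combE phi t x y.
case: (boolP (i == 0)) => [/eqP->|i0].
  by rewrite E0 /x /y; ring: cs.
have -> : i = 1 by apply/val_inj; case: i i0 => -[|[|]].
by rewrite E1 /x /y; ring: cs.
Qed.

Theorem theorem2p1 (R : realType) (D : set R) (r phi : R -> R)
    (apar aperp : nat -> R -> R) (k : nat)
    (openD : open D)
    (r_diff : times_derivable k.+1 D r)
    (phi_diff : times_derivable k.+1 D phi)
    (comp : forall j : nat, (j <= k.+1)%N -> forall t : R, D t ->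
      has_components (dirvec phi t) (derive1n j (position r phi) t)
        (apar j t) (aperp j t)) :
  forall t : R, D t ->
    [/\ derivable (derive1n k (position r phi)) t 1,
        derivable (apar k) t 1 /\ derivable (aperp k) t 1,
        derive1n k.+1 (position r phi) t =
          (derive1 (apar k) t - derive1 phi t * aperp k t) *: dirvec phi t
          + (derive1 (aperp k) t + derive1 phi t * apar k t) *: tilde (dirvec phi t),
        apar k.+1 t = derive1 (apar k) t - derive1 phi t * aperp k t
      & aperp k.+1 t = derive1 (aperp k) t + derive1 phi t * apar k t].
Proof.
move=> t Dt.
have [dcos dsin] := times_derivable_cos_sin openD phi_diff.
(* The two entries are [r cos phi] and [r sin phi]. *)
have dpos i j : times_derivable k.+1 D (fun s => position r phi s i j).
  case: i => -[|[|//]] i2; [have := times_derivableM openD r_diff dcos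
                          | have := times_derivableM openD r_diff dsin];
  by apply: (eq_times_derivable openD) => s Ds; rewrite !mxE.
set U := derive1n k (position r phi).
have dU : derivable U t 1 := derivable_derive1n_mx openD dpos (ltnSn k) Dt.
have dUij i j := (derivable_mxP U t 1).1 dU i j.
have dphi : is_derive t 1 phi (derive1 phi t).
  by rewrite derive1E; apply/derivableP/(phi_diff 0%N).
have compk s (Ds : D s) := (has_componentsP _ _ _ _ _).1 (comp k (leqnSn k) s Ds).
have DU0 : is_derive t 1 (fun s => U s 0 0) ('D_1 (fun s => U s 0 0) t) by exact/derivableP.
have DU1 : is_derive t 1 (fun s => U s 1 0) ('D_1 (fun s => U s 1 0) t) by exact/derivableP.
set u0 := 'D_1 _ t in DU0; set u1 := 'D_1 _ t in DU1.
(* No regularity of [apar k] and [aperp k] is assumed: they inherit it from these explicit formulas,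
   with which they agree on [D]. *)
pose x := (fun s => U s 0 0) * (cos \o phi) + (fun s => U s 1 0) * (sin \o phi).
pose y := (fun s => U s 1 0) * (cos \o phi) - (fun s => U s 0 0) * (sin \o phi).
have xE : {near t, x =1 apar k}.
  by apply: (open_near_eq openD) Dt => s Ds; rewrite (compk s Ds).1.
have yE : {near t, y =1 aperp k}.
  by apply: (open_near_eq openD) Dt => s Ds; rewrite (compk s Ds).2.
have dx : derivable x t 1 by apply: ex_derive.
have dy : derivable y t 1 by apply: ex_derive.
have [aE bE] := compk t Dt.
have [aSE bSE] := (has_componentsP _ _ _ _ _).1 (comp k.+1 (leqnn _) t Dt).
have US : derive1n k.+1 (position r phi) t = 'D_1 U t by rewrite derive1nS derive1E.
(* The derivative of [x] is [u0 cos phi + u1 sin phi], which is [apar k.+1 t], plus [phi'] times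
   [U 1 0 cos phi - U 0 0 sin phi], which is [aperp k t]. *)
have Ea : apar k.+1 t = derive1 (apar k) t - derive1 phi t * aperp k t.
  rewrite aSE US derive_mx // !mxE -/u0 -/u1 derive1E -(near_eq_derive _ xE).
  rewrite derive_val bE /= /GRing.scale /=; ring.
have Eb : aperp k.+1 t = derive1 (aperp k) t + derive1 phi t * apar k t.
  rewrite bSE US derive_mx // !mxE -/u0 -/u1 derive1E -(near_eq_derive _ yE).
  rewrite derive_val aE /= /GRing.scale /=; ring.
split=> //.
- by split; [exact: near_eq_derivable xE dx|exact: near_eq_derivable yE dy].
- by rewrite -Ea -Eb; exact: comp.
Qed.
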